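(* Let $d\geq0$ be an even integer and let $k_0,k_1,k_2,k_3$ be nonzero scalars in $\mathbb{F}$ with $k_0k_1k_2k_3=q^{-d-1}$. If the $\mathfrak{H}_q$-module $O(k_0,k_1,k_2,k_3)$ is irreducible, then the following hold: (i) $O(k_0,k_1,k_2,k_3)$ is isomorphic to the $\mathfrak{H}_q$-module $O(k_1,k_2,k_3,k_0)^{3\bmod 4}$. (ii) $O(k_0,k_1,k_2,k_3)$ is isomorphic to the $\mathfrak{H}_q$-module $O(k_2,k_3,k_0,k_1)^{2\bmod 4}$. (iii) $O(k_0,k_1,k_2,k_3)$ is isomorphic to the $\mathfrak{H}_q$-module $O(k_3,k_0,k_1,k_2)^{1\bmod 4}$.
   Context: $\mathbb{F}$ is a field and $q\in\mathbb{F}$ is nonzero. The universal DAHA $\mathfrak{H}_q$ of type $(C_1^\vee,C_1)$ is the unital associative $\mathbb{F}$-algebra with generators $t_0^{\pm1},t_1^{\pm1},t_2^{\pm1},t_3^{\pm1}$ and relations: $t_it_i^{-1}=t_i^{-1}t_i=1$ for all $i$; $t_i+t_i^{-1}$ is central for all $i$; $t_0t_1t_2t_3=q^{-1}$. The group $\mathbb{Z}/4\mathbb{Z}$ acts on $\mathfrak{H}_q$ by $\mathbb{F}$-algebra automorphisms: $\varepsilon\in\mathbb{Z}/4\mathbb{Z}$ sends $t_i\mapsto t_{i+\varepsilon}$ (indices mod $4$). For an $\mathfrak{H}_q$-module $V$, $V^\varepsilon$ denotes the module obtained by twisting $V$ via $\varepsilon$: the same vector space, with $x\in\mathfrak{H}_q$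 acting on $V^\varepsilon$ as $\varepsilon(x)$ acts on $V$. For an integer $j$, $V^{j\bmod 4}$ is the twist by the class of $j$. For an even integer $d\ge0$ and nonzero $k_0,k_1,k_2,k_3\in\mathbb{F}$ with $k_0k_1k_2k_3=q^{-d-1}$, $O(k_0,k_1,k_2,k_3)$ denotes the $(d+1)$-dimensional $\mathfrak{H}_q$-module with $\mathbb{F}$-basis $\{v_i\}_{i=0}^d$ and action - $t_0v_i=k_0^{-1}q^{-i}(1-q^i)(1-k_0^2q^i)v_{i-1}+(k_0+k_0^{-1}-k_0^{-1}q^{-i})v_i$ for $i=2,4,\ldots,d$; $t_0v_i=k_0^{-1}q^{-i-1}(v_i-v_{i+1})$ for $i=1,3,\ldots,d-1$; $t_0v_0=k_0v_0$; - $t_1v_i=-k_1(1-q^i)(1-k_0^2q^i)v_{i-1}+k_1v_i+k_1^{-1}v_{i+1}$ for $i=2,4,\ldots,d-2$; $t_1v_i=k_1^{-1}v_i$ for $i=1,3,\ldots,d-1$; $t_1v_0=k_1v_0+k_1^{-1}v_1$; $t_1v_d=-k_1(1-q^d)(1-k_0^2q^d)v_{d-1}+k_1v_d$; - $t_2v_i=k_2q^{d-i}(v_i-v_{i+1})$ for $i=0,2,\ldots,d-2$; $t_2v_i=-k_2(1-k_2^{-2}q^{i-d-1})(1-q^{d-i+1})v_{i-1}+(k_2+k_2^{-1}-k_2q^{d-i+1})v_i$ for $i=1,3,\ldots,d-1$; $t_2v_d=k_2v_d$; - $t_3v_i=k_3v_i$ for $i=0,2,\ldots,d$; $t_3v_i=-k_3^{-1}(1-k_2^{-2}q^{i-d-1})(1-q^{i-d-1})v_{i-1}+k_3^{-1}v_i+k_3v_{i+1}$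 for $i=1,3,\ldots,d-1$. (When $d=0$ read $v_{-1}=v_1=0$, so $t_iv_0=k_iv_0$ for all $i$. These formulas do define an $\mathfrak{H}_q$-module.) *)

(* Defs.v *)
From HB Require Import structures.
From mathcomp Require Import all_boot all_order all_algebra.
From mathcomp Require Import boolp.
From mathcomp Require Import ring.

Set Implicit Arguments.
Unset Strict Implicit.
Unset Printing Implicit Defensive.
Import GRing.Theory.
Local Open Scope ring_scope.
Local Open Scope quotient_scope.

(* The algebra is presented by generators and relations: noncommutative
   polynomial expressions in the t_i and their formal inverses, modulo the
   least congruence containing the axioms of unital associative F-algebras
   and the defining relations. *)
Inductive expr (F : Type) : Type :=
| Const of F
| Gen of 'Z_4
| GenV of 'Z_4
| Add of expr F & expr F
| Mul of expr F & expr F.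
Arguments Gen {F}.
Arguments GenV {F}.

Section Congruence.
Variables (F : fieldType) (q : F).

Inductive cong : expr F -> expr F -> Prop :=
| cong_refl x : cong x x
| cong_sym x y : cong x y -> cong y x
| cong_trans x y z : cong x y -> cong y z -> cong x z
| cong_Add x x' y y' : cong x x' -> cong y y' -> cong (Add x y) (Add x' y')
| cong_Mul x x' y y' : cong x x' -> cong y y' -> cong (Mul x y) (Mul x' y')
| cong_addA x y z : cong (Add x (Add y z)) (Add (Add x y) z)
| cong_addC x y : cong (Add x y) (Add y x)
| cong_add0 x : cong (Add (Const 0) x) x
| cong_mulA x y z : cong (Mul x (Mul y z)) (Mul (Mul x y) z)
| cong_mul1 x : cong (Mul (Const 1) x) x
| cong_mul0 x : cong (Mul (Const 0) x) (Const 0)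
| cong_mulDl x y z : cong (Mul (Add x y) z) (Add (Mul x z) (Mul y z))
| cong_mulDr x y z : cong (Mul x (Add y z)) (Add (Mul x y) (Mul x z))
| cong_constD a b : cong (Const (a + b)) (Add (Const a) (Const b))
| cong_constM a b : cong (Const (a * b)) (Mul (Const a) (Const b))
| cong_constC a x : cong (Mul (Const a) x) (Mul x (Const a))
| cong_genV i : cong (Mul (Gen i) (GenV i)) (Const 1)
| cong_genVl i : cong (Mul (GenV i) (Gen i)) (Const 1)
| cong_central i x :
    cong (Mul (Add (Gen i) (GenV i)) x) (Mul x (Add (Gen i) (GenV i)))
| cong_prod :
    cong (Mul (Mul (Mul (Gen 0) (Gen 1)) (Gen 2)) (Gen 3)) (Const q^-1).

Definition congb : rel {classic expr F} := fun x y => `[< cong x y >].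

Lemma congb_refl : reflexive congb.
Proof. by move=> x; apply/asboolP/cong_refl. Qed.

Lemma congb_sym : symmetric congb.
Proof. by move=> x y; apply/asboolP/asboolP; apply: cong_sym. Qed.

Lemma congb_trans : transitive congb.
Proof.
by move=> y x z /asboolP xy /asboolP yz; apply/asboolP; apply: cong_trans yz.
Qed.

Canonical cong_equiv := EquivRel congb congb_refl congb_sym congb_trans.

End Congruence.

Section DAHA.
Variables (F : fieldType) (q : F).

(* q != 0 makes the algebra nontrivial, as algType requires. *)
Definition DAHA (hq : q != 0) : Type := {eq_quot @cong_equiv F q}.

Variable hq : q != 0.
Local Notation H := (DAHA hq).

HB.instance Definition _ := Choice.copy H {eq_quot @cong_equiv F q}.

Definition cls (x : expr F) : H := \pi_({eq_quot @cong_equiv F q}) x.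
Definition rp (x : H) : expr F := repr (x : {eq_quot @cong_equiv F q}).

Lemma rpK x : cls (rp x) = x.
Proof. exact: reprK. Qed.

Lemma cls_eq x y : cls x = cls y <-> cong q x y.
Proof.
split=> [/eqP|xy]; first by rewrite eqmodE => /asboolP.
by apply/eqP; rewrite eqmodE; apply/asboolP.
Qed.

Lemma rp_cls x : cong q (rp (cls x)) x.
Proof. by apply/cls_eq; rewrite rpK. Qed.

Definition Hadd (x y : H) : H := cls (Add (rp x) (rp y)).
Definition Hmul (x y : H) : H := cls (Mul (rp x) (rp y)).
Definition Hconst (a : F) : H := cls (Const a).
Definition Hopp (x : H) : H := Hmul (Hconst (-1)) x.

Lemma cls_add x y : Hadd (cls x) (cls y) = cls (Add x y).
Proof. by apply/cls_eq/cong_Add; apply: rp_cls. Qed.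

Lemma cls_mul x y : Hmul (cls x) (cls y) = cls (Mul x y).
Proof. by apply/cls_eq/cong_Mul; apply: rp_cls. Qed.

Lemma HaddA : associative Hadd.
Proof.
move=> x y z; rewrite -[x]rpK -[y]rpK -[z]rpK !cls_add.
exact/cls_eq/cong_addA.
Qed.

Lemma HaddC : commutative Hadd.
Proof. move=> x y; exact/cls_eq/cong_addC. Qed.

Lemma Hadd0 : left_id (Hconst 0) Hadd.
Proof. move=> x; rewrite -[x]rpK cls_add; exact/cls_eq/cong_add0. Qed.

Lemma HmulA : associative Hmul.
Proof.
move=> x y z; rewrite -[x]rpK -[y]rpK -[z]rpK !cls_mul.
exact/cls_eq/cong_mulA.
Qed.

Lemma HconstC a x : Hmul (Hconst a) x = Hmul x (Hconst a).
Proof. rewrite -[x]rpK !cls_mul; exact/cls_eq/cong_constC. Qed.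

Lemma Hmul1 : left_id (Hconst 1) Hmul.
Proof. move=> x; rewrite -[x]rpK cls_mul; exact/cls_eq/cong_mul1. Qed.

Lemma Hmulr1 : right_id (Hconst 1) Hmul.
Proof. by move=> x; rewrite -HconstC Hmul1. Qed.

Lemma HmulDl : left_distributive Hmul Hadd.
Proof.
move=> x y z; rewrite -[x]rpK -[y]rpK -[z]rpK !(cls_mul, cls_add).
exact/cls_eq/cong_mulDl.
Qed.

Lemma HmulDr : right_distributive Hmul Hadd.
Proof.
move=> x y z; rewrite -[x]rpK -[y]rpK -[z]rpK !(cls_mul, cls_add).
exact/cls_eq/cong_mulDr.
Qed.

Lemma HconstD a b : Hconst (a + b) = Hadd (Hconst a) (Hconst b).
Proof. rewrite cls_add; exact/cls_eq/cong_constD. Qed.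

Lemma HconstM a b : Hconst (a * b) = Hmul (Hconst a) (Hconst b).
Proof. rewrite cls_mul; exact/cls_eq/cong_constM. Qed.

Lemma HaddN : left_inverse (Hconst 0) Hopp Hadd.
Proof.
move=> x; rewrite /Hopp -{2}[x]Hmul1 -HmulDl -HconstD addNr.
rewrite -[x]rpK cls_mul; exact/cls_eq/cong_mul0.
Qed.

HB.instance Definition _ :=
  GRing.isZmodule.Build H HaddA HaddC Hadd0 HaddN.
HB.instance Definition _ :=
  GRing.Zmodule_isPzRing.Build H HmulA Hmul1 Hmulr1 HmulDl HmulDr.

End DAHA.

Section Eval.
Variables (F : fieldType) (q : F).

Record DAHA_family (A : algType F) (t s : 'Z_4 -> A) : Prop := DAHAFamily {
  fam_mulV : forall i, t i * s i = 1;
  fam_mulVl : forall i, s i * t i = 1;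
  fam_central : forall i j, GRing.comm (t i + s i) (t j);
  fam_prod : t 0 * t 1 * t 2 * t 3 = q^-1%:A }.

Fixpoint eval (A : algType F) (t s : 'Z_4 -> A) (x : expr F) : A :=
  match x with
  | Const a => a%:A
  | Gen i => t i
  | GenV i => s i
  | Add x y => eval t s x + eval t s y
  | Mul x y => eval t s x * eval t s y
  end.

Variables (A : algType F) (t s : 'Z_4 -> A).
Hypothesis ts : DAHA_family t s.

Lemma eval_central i x : GRing.comm (t i + s i) (eval t s x).
Proof.
elim: x => [a|j|j|x IHx y IHy|x IHx y IHy] /=.
- by rewrite /GRing.comm mulr_algl mulr_algr.
- exact: fam_central.
- have c := fam_central ts i j; rewrite /GRing.comm.
  rewrite -[LHS]mul1r -(fam_mulVl ts j) -[s j * t j * _]mulrA.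
  rewrite [t j * _]mulrA -c -[_ * t j * _]mulrA.
  by rewrite (fam_mulV ts j) mulr1.
- exact: commrD.
- exact: commrM.
Qed.

Lemma eval_cong x y : cong q x y -> eval t s x = eval t s y.
Proof.
elim=> {x y} //=.
- by move=> x y z _ -> _ ->.
- by move=> x x' y y' _ -> _ ->.
- by move=> x x' y y' _ -> _ ->.
- by move=> x y z; rewrite addrA.
- by move=> x y; rewrite addrC.
- by move=> x; rewrite scale0r add0r.
- by move=> x y z; rewrite mulrA.
- by move=> x; rewrite scale1r mul1r.
- by move=> x; rewrite scale0r mul0r.
- by move=> x y z; rewrite mulrDl.
- by move=> x y z; rewrite mulrDr.
- by move=> a b; rewrite scalerDl.
- by move=> a b; rewrite -scalerAl mul1r scalerA.
- by move=> a x; rewrite mulr_algl mulr_algr.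
- by move=> i; rewrite scale1r (fam_mulV ts).
- by move=> i; rewrite scale1r (fam_mulVl ts).
- by move=> i x; apply: eval_central.
- exact: (fam_prod ts).
Qed.

End Eval.

Section Algebra.
Variables (F : fieldType) (q : F) (hq : q != 0).
Local Notation H := (DAHA hq).

Definition triv_gen (i : 'Z_4) : F^o := if i == 3 then q^-1 else 1.

Lemma triv_family :
  DAHA_family q triv_gen (fun i => (triv_gen i)^-1 : F^o).
Proof.
have nz i : triv_gen i != 0.
  by rewrite /triv_gen; case: ifP; rewrite ?invr_eq0 ?oner_eq0.
split=> [i|i|i j|].
- exact: mulfV.
- exact: mulVf.
- exact: mulrC.
- by rewrite /triv_gen /= !mul1r /GRing.scale /= mulr1.
Qed.

Lemma DAHA_nontriv : (1 : H) != 0.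
Proof.
apply/eqP => /cls_eq /(eval_cong triv_family) /= /eqP.
by rewrite scale1r scale0r oner_eq0.
Qed.

HB.instance Definition _ := GRing.PzSemiRing_isNonZero.Build H DAHA_nontriv.

Definition Hscale (a : F) (x : H) : H := Hconst hq a * x.

Lemma HscaleA a b x : Hscale a (Hscale b x) = Hscale (a * b) x.
Proof. by rewrite /Hscale HconstM [RHS]/GRing.mul /= -HmulA. Qed.

Lemma Hscale1 : left_id 1 Hscale.
Proof. exact: mul1r. Qed.

Lemma HscaleDr : right_distributive Hscale +%R.
Proof. by move=> a x y; apply: mulrDr. Qed.

Lemma HscaleDl x : {morph Hscale^~ x : a b / a + b}.
Proof. by move=> a b; rewrite /Hscale HconstD; apply: mulrDl. Qed.

HB.instance Definition _ :=
  GRing.Zmodule_isLmodule.Build F H HscaleA Hscale1 HscaleDr HscaleDl.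

Lemma HscaleAl (a : F) (x y : H) : a *: (x * y) = (a *: x) * y.
Proof. exact: mulrA. Qed.

HB.instance Definition _ := GRing.Lmodule_isLalgebra.Build F H HscaleAl.

Lemma HscaleAr (a : F) (x y : H) : a *: (x * y) = x * (a *: y).
Proof.
rewrite [LHS]mulrA [RHS]mulrA; congr (_ * y); exact: HconstC.
Qed.

HB.instance Definition _ := GRing.Lalgebra_isAlgebra.Build F H HscaleAr.

Definition tgen (i : 'Z_4) : H := cls hq (Gen i).
Definition tgenV (i : 'Z_4) : H := cls hq (GenV i).

Lemma HconstE a : Hconst hq a = a%:A.
Proof. by rewrite -[LHS]mulr1. Qed.

Lemma tgenK i : tgen i * tgenV i = 1.
Proof. rewrite [LHS]cls_mul; exact/cls_eq/cong_genV. Qed.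

Lemma tgenVK i : tgenV i * tgen i = 1.
Proof. rewrite [LHS]cls_mul; exact/cls_eq/cong_genVl. Qed.

Lemma tgen_central i x : GRing.comm (tgen i + tgenV i) x.
Proof.
rewrite /GRing.comm [tgen i + _]cls_add -[x]rpK.
by rewrite [LHS]cls_mul [RHS]cls_mul; apply/cls_eq/cong_central.
Qed.

Lemma tgen_prod : tgen 0 * tgen 1 * tgen 2 * tgen 3 = q^-1%:A.
Proof.
rewrite -HconstE [tgen 0 * _]cls_mul [_ * tgen 2]cls_mul [LHS]cls_mul.
exact/cls_eq/cong_prod.
Qed.

End Algebra.

Section Lift.
Variables (F : fieldType) (q : F) (hq : q != 0).
Local Notation H := (DAHA hq).
Variables (A : algType F) (t s : 'Z_4 -> A).

Definition DAHA_lift (ts : DAHA_family q t s) (x : H) : A := eval t s (rp x).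

Variable ts : DAHA_family q t s.

Lemma lift_cls x : DAHA_lift ts (cls hq x) = eval t s x.
Proof. exact/(eval_cong ts)/rp_cls. Qed.

Lemma lift_tgen i : DAHA_lift ts (tgen hq i) = t i.
Proof. exact: lift_cls. Qed.

Lemma lift_tgenV i : DAHA_lift ts (tgenV hq i) = s i.
Proof. exact: lift_cls. Qed.

Lemma lift_add x y : DAHA_lift ts (x + y) = DAHA_lift ts x + DAHA_lift ts y.
Proof. exact: lift_cls. Qed.

Lemma lift_zmod : zmod_morphism (DAHA_lift ts).
Proof.
by move=> x y; apply/(addIr (DAHA_lift ts y)); rewrite -lift_add !subrK.
Qed.

Lemma lift_monoid : monoid_morphism (DAHA_lift ts).
Proof.
split; first by rewrite [LHS]lift_cls /= scale1r.
by move=> x y; apply: lift_cls.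
Qed.

Lemma lift_scalable : scalable (DAHA_lift ts).
Proof.
move=> a x; rewrite -[a *: x]mulr_algl -HconstE.
by rewrite (lift_monoid.2) [DAHA_lift ts (Hconst _ _)]lift_cls /= mulr_algl.
Qed.

HB.instance Definition _ :=
  GRing.isZmodMorphism.Build H A (DAHA_lift ts) lift_zmod.
HB.instance Definition _ :=
  GRing.isMonoidMorphism.Build H A (DAHA_lift ts) lift_monoid.
HB.instance Definition _ :=
  GRing.isScalable.Build F H A *:%R (DAHA_lift ts) lift_scalable.

End Lift.

Section Rotation.
Variables (F : fieldType) (q : F) (hq : q != 0).
Local Notation H := (DAHA hq).

Lemma tgen_rot (i : 'Z_4) :
  tgen hq i * tgen hq (1 + i) * tgen hq (2 + i) * tgen hq (3 + i) = q^-1%:A.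
Proof.
have step (a a' b c d : H) : a' * a = 1 -> a * b * c * d = q^-1%:A ->
    b * c * d * a = q^-1%:A.
  move=> a'a abcd; have -> : b * c * d = a' * (a * b * c * d).
    by rewrite !mulrA a'a mul1r.
  by rewrite abcd mulr_algr -scalerAl a'a.
have nxt (j : 'Z_4) :
    tgen hq j * tgen hq (1 + j) * tgen hq (2 + j) * tgen hq (3 + j) = q^-1%:A ->
    tgen hq (1 + j) * tgen hq (1 + (1 + j)) * tgen hq (2 + (1 + j))
      * tgen hq (3 + (1 + j)) = q^-1%:A.
  have e1 : 1 + 1 = 2 :> 'Z_4 by apply/val_inj.
  have e2 : 2 + 1 = 3 :> 'Z_4 by apply/val_inj.
  have e3 : 3 + 1 = 0 :> 'Z_4 by apply/val_inj.
  by rewrite !addrA e1 e2 e3 add0r; apply: (step _ (tgenV hq j)) (tgenVK hq j).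
have h0 : tgen hq 0 * tgen hq (1 + 0) * tgen hq (2 + 0) * tgen hq (3 + 0)
    = q^-1%:A by rewrite !addr0; apply: tgen_prod.
rewrite -[i]natr_Zp; elim: (i : nat) => [//|n IHn].
have -> : n.+1%:R = 1 + n%:R :> 'Z_4 by rewrite -natr1 addrC.
exact: nxt.
Qed.

Lemma rot_family (e : 'Z_4) :
  DAHA_family q (fun i => tgen hq (i + e)) (fun i => tgenV hq (i + e)).
Proof.
split=> [i|i|i j|]; [exact: tgenK|exact: tgenVK|exact: tgen_central|].
by rewrite add0r; apply: tgen_rot.
Qed.

Definition DAHA_rot (e : 'Z_4) : H -> H := DAHA_lift (rot_family e).
HB.instance Definition _ e := GRing.LRMorphism.on (DAHA_rot e).

Lemma rot_tgen e i : DAHA_rot e (tgen hq i) = tgen hq (i + e).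
Proof. exact: lift_tgen. Qed.

Definition twist (e : 'Z_4) (V : lmodType H) : Type := V.

Variables (e : 'Z_4) (V : lmodType H).
HB.instance Definition _ := GRing.Zmodule.copy (twist e V) V.

Definition twist_scale (x : H) (v : twist e V) : twist e V :=
  DAHA_rot e x *: (v : V).

Lemma twist_scaleA x y v :
  twist_scale x (twist_scale y v) = twist_scale (x * y) v.
Proof. by rewrite /twist_scale scalerA rmorphM. Qed.

Lemma twist_scale1 : left_id 1 twist_scale.
Proof. by move=> v; rewrite /twist_scale rmorph1 scale1r. Qed.

Lemma twist_scaleDr : right_distributive twist_scale +%R.
Proof. by move=> x u v; apply: scalerDr. Qed.

Lemma twist_scaleDl v : {morph twist_scale^~ v : x y / x + y}.
Proof. by move=> x y; rewrite /twist_scale rmorphD; apply: scalerDl. Qed.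

HB.instance Definition _ := GRing.Zmodule_isLmodule.Build H (twist e V)
  twist_scaleA twist_scale1 twist_scaleDr twist_scaleDl.

End Rotation.

Definition irreducible_module (R : pzRingType) (V : lmodType R) : Prop :=
  (exists v : V, v != 0) /\
  (forall S : {pred V}, submod_closed S ->
     (forall v, v \in S -> v = 0) \/ (forall v, v \in S)).

Definition isomorphic_modules (R : pzRingType) (V W : lmodType R) : Prop :=
  exists f : {linear V -> W}, bijective f.

Section OAction.
Variables (F : fieldType) (q : F) (d : nat) (k0 k1 k2 k3 : F).

(* The basis vector v_i of F^(d+1), with v_i = 0 for i > d. *)
Definition Ov (i : nat) : 'cV[F]_d.+1 := \col_(a < d.+1) (a == i :> nat)%:R.

(* O_t j i is t_j v_i, for i <= d. *)
Definition O_t0 (i : nat) : 'cV[F]_d.+1 :=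
  if odd i then (k0^-1 * q ^- i.+1) *: (Ov i - Ov i.+1)
  else if i == 0%N then k0 *: Ov 0
  else (k0^-1 * q ^- i * (1 - q ^+ i) * (1 - k0 ^+ 2 * q ^+ i)) *: Ov i.-1
       + (k0 + k0^-1 - k0^-1 * q ^- i) *: Ov i.

Definition O_t1 (i : nat) : 'cV[F]_d.+1 :=
  if odd i then k1^-1 *: Ov i
  else if i == 0%N then k1 *: Ov 0 + k1^-1 *: Ov 1
  else if i == d then
    (- k1 * (1 - q ^+ d) * (1 - k0 ^+ 2 * q ^+ d)) *: Ov d.-1 + k1 *: Ov d
  else (- k1 * (1 - q ^+ i) * (1 - k0 ^+ 2 * q ^+ i)) *: Ov i.-1
       + k1 *: Ov i + k1^-1 *: Ov i.+1.

Definition O_t2 (i : nat) : 'cV[F]_d.+1 :=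
  if odd i then
    (- k2 * (1 - k2 ^- 2 * q ^ (i%:Z - d%:Z - 1))
        * (1 - q ^ (d%:Z - i%:Z + 1))) *: Ov i.-1
    + (k2 + k2^-1 - k2 * q ^ (d%:Z - i%:Z + 1)) *: Ov i
  else if i == d then k2 *: Ov d
  else (k2 * q ^ (d%:Z - i%:Z)) *: (Ov i - Ov i.+1).

Definition O_t3 (i : nat) : 'cV[F]_d.+1 :=
  if odd i then
    (- k3^-1 * (1 - k2 ^- 2 * q ^ (i%:Z - d%:Z - 1))
        * (1 - q ^ (i%:Z - d%:Z - 1))) *: Ov i.-1
    + k3^-1 *: Ov i + k3 *: Ov i.+1
  else k3 *: Ov i.

Definition O_t (j : 'Z_4) : nat -> 'cV[F]_d.+1 :=
  nth O_t0 [:: O_t0; O_t1; O_t2; O_t3] j.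

(* The matrix of t_j, acting on column vectors: its i-th column is t_j v_i. *)
Definition O_mx (j : 'Z_4) : 'M[F]_d.+1 := \matrix_(a, i) O_t j i a 0.

Definition O_par (j : 'Z_4) : F := nth k0 [:: k0; k1; k2; k3] j.
Definition O_mxV (j : 'Z_4) : 'M[F]_d.+1 :=
  (O_par j + (O_par j)^-1)%:M - O_mx j.

Record O_params : Prop := OParams {
  O_even : ~~ odd d;
  O_k0 : k0 != 0;
  O_k1 : k1 != 0;
  O_k2 : k2 != 0;
  O_k3 : k3 != 0;
  O_kprod : k0 * k1 * k2 * k3 = q ^ (- d%:Z - 1) }.

Hypotheses (hq : q != 0) (hO : O_params).

Lemma OvE (i : 'I_d.+1) : Ov i = delta_mx i 0.
Proof. by apply/colP => a; rewrite !mxE eqxx andbT. Qed.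

Lemma Ov_out i : (d < i)%N -> Ov i = 0.
Proof.
move=> di; apply/colP => a; rewrite !mxE; case: eqP => // ai.
by move: (ltn_ord a); rewrite ai ltnS leqNgt di.
Qed.

Lemma O_mxE j i : O_mx j *m Ov i = if (i <= d)%N then O_t j i else 0.
Proof.
case: leqP => [le_id|/Ov_out->]; last by rewrite mulmx0.
rewrite (OvE (Ordinal (le_id : (i < d.+1)%N))) -colE.
by apply/colP => a; rewrite !mxE.
Qed.

Lemma mx_ext (M N : 'M[F]_d.+1) :
  (forall i, M *m Ov i = N *m Ov i) -> M = N.
Proof.
move=> MN; apply/matrixP => a b.
by move/colP/(_ a): (MN b); rewrite !OvE -!colE !mxE.
Qed.

(* Uniform versions of the formulas: out-of-range terms vanish. *)
Lemma O_even_d : d = d./2.*2.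
Proof. by rewrite -[LHS]odd_double_half (negbTE (O_even hO)). Qed.

Lemma O_range_even m : (m.*2 <= d)%N = (m <= d./2)%N.
Proof. by rewrite {1}O_even_d leq_double. Qed.

Lemma O_range_odd m : (m.*2.+1 <= d)%N = (m < d./2)%N.
Proof. by rewrite {1}O_even_d ltn_double. Qed.

Let u m := q ^+ m.*2.
Let D := q ^+ d.

Lemma u_neq0 m : u m != 0. Proof. exact: expf_neq0. Qed.
Lemma D_neq0 : D != 0. Proof. exact: expf_neq0. Qed.
Lemma uS m : u m.+1 = u m * q * q.
Proof. by rewrite /u doubleS !exprSr. Qed.

Ltac nz := rewrite ?oner_eq0 ?(O_k0 hO) ?(O_k1 hO) ?(O_k2 hO) ?(O_k3 hO)
  ?hq ?u_neq0 ?D_neq0 //.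
Ltac vec := apply/colP => a; rewrite !mxE; field; nz.

Lemma odd_dblS m : odd m.*2.+1 = true.
Proof. by rewrite /= odd_double. Qed.

Lemma O0_even m : O_mx 0 *m Ov m.*2 =
  (k0^-1 * (u m)^-1 * (1 - u m) * (1 - k0 ^+ 2 * u m)) *: Ov m.*2.-1
  + (k0 + k0^-1 - k0^-1 * (u m)^-1) *: Ov m.*2.
Proof.
rewrite O_mxE; case: leqP => [|lt].
  rewrite (_ : O_t 0 = O_t0) // /O_t0 odd_double; case: m => [|m] _ //=.
  by rewrite /u expr0; vec.
rewrite (Ov_out lt) Ov_out ?scaler0 ?addr0 //.
move: lt; rewrite {1 2}O_even_d; case: m => // m.
by rewrite ltn_double doubleS /= !ltnS leq_double.
Qed.

Lemma O0_odd m : O_mx 0 *m Ov m.*2.+1 =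
  (k0^-1 * (u m.+1)^-1) *: (Ov m.*2.+1 - Ov m.+1.*2).
Proof.
rewrite O_mxE; case: ltnP => [le|lt].
  by rewrite (_ : O_t 0 = O_t0) // /O_t0 odd_dblS.
by rewrite !Ov_out ?subrr ?scaler0 // doubleS ltnW.
Qed.

Lemma O1_even m : O_mx 1 *m Ov m.*2 =
  (- k1 * (1 - u m) * (1 - k0 ^+ 2 * u m)) *: Ov m.*2.-1
  + k1 *: Ov m.*2 + k1^-1 *: Ov m.*2.+1.
Proof.
rewrite O_mxE; case: leqP => [|lt].
  rewrite (_ : O_t 1 = O_t1) // /O_t1 odd_double; case: m => [|m] _.
    by rewrite eqxx /u expr0; vec.
  rewrite -[m.+1.*2 == 0%N]/false; case: eqP => // dE.
  by rewrite (Ov_out (i := m.+1.*2.+1)) /u dE ?scaler0 ?addr0.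
rewrite !(Ov_out lt) !Ov_out ?scaler0 ?addr0 // ?leqW //.
move: lt; rewrite {1 2}O_even_d; case: m => // m.
by rewrite ltn_double doubleS /= !ltnS leq_double.
Qed.

Lemma O1_odd m : O_mx 1 *m Ov m.*2.+1 = k1^-1 *: Ov m.*2.+1.
Proof.
rewrite O_mxE; case: ltnP => [le|lt].
  by rewrite (_ : O_t 1 = O_t1) // /O_t1 odd_dblS.
by rewrite Ov_out // scaler0.
Qed.

Lemma qzE1 m : q ^ (m.*2.+1%:Z - d%:Z - 1) = u m / D.
Proof.
rewrite -addn1 PoszD addrAC addrK expfzDr //.
by rewrite -exprnN.
Qed.

Lemma qzE2 m : q ^ (d%:Z - m.*2.+1%:Z + 1) = D / u m.
Proof.
rewrite -addn1 PoszD opprD addrA subrK expfzDr //.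
by rewrite -exprnN.
Qed.

Lemma qzE3 m : q ^ (d%:Z - m.*2%:Z) = D / u m.
Proof. by rewrite expfzDr // -exprnN. Qed.

Lemma O2_even m : O_mx 2 *m Ov m.*2 =
  (k2 * (D / u m)) *: (Ov m.*2 - Ov m.*2.+1).
Proof.
rewrite O_mxE; case: leqP => [le|lt]; last first.
  by rewrite !Ov_out ?subrr ?scaler0 // leqW.
rewrite (_ : O_t 2 = O_t2) // /O_t2 odd_double.
case: eqP => [dE|_]; last by rewrite qzE3.
by rewrite dE (Ov_out (i := d.+1)) // subr0 /u dE divff ?D_neq0 // mulr1.
Qed.

Lemma O2_odd m : O_mx 2 *m Ov m.*2.+1 =
  (- k2 * (1 - k2 ^- 2 * (u m / D)) * (1 - D / u m)) *: Ov m.*2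
  + (k2 + k2^-1 - k2 * (D / u m)) *: Ov m.*2.+1.
Proof.
rewrite O_mxE; case: ltnP => [le|lt].
  by rewrite (_ : O_t 2 = O_t2) // /O_t2 odd_dblS qzE1 qzE2.
rewrite (Ov_out (lt : (d < m.*2.+1)%N)) scaler0 addr0.
move: lt; rewrite leq_eqVlt => /orP[/eqP dE|lt'].
  by rewrite /u -dE divff ?D_neq0 // subrr mulr0 scale0r.
by rewrite (Ov_out lt') scaler0.
Qed.

Lemma O3_even m : O_mx 3 *m Ov m.*2 = k3 *: Ov m.*2.
Proof.
rewrite O_mxE; case: leqP => [le|lt].
  by rewrite (_ : O_t 3 = O_t3) // /O_t3 odd_double.
by rewrite Ov_out // scaler0.
Qed.

Lemma O3_odd m : O_mx 3 *m Ov m.*2.+1 =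
  (- k3^-1 * (1 - k2 ^- 2 * (u m / D)) * (1 - u m / D)) *: Ov m.*2
  + k3^-1 *: Ov m.*2.+1 + k3 *: Ov m.+1.*2.
Proof.
rewrite O_mxE; case: ltnP => [le|lt].
  by rewrite (_ : O_t 3 = O_t3) // /O_t3 odd_dblS qzE1.
rewrite (Ov_out (lt : (d < m.*2.+1)%N)).
rewrite (Ov_out (i := m.+1.*2)) ?doubleS ?ltnS ?leqW //.
rewrite !scaler0 !addr0.
move: lt; rewrite leq_eqVlt => /orP[/eqP dE|lt'].
  by rewrite /u -dE divff ?D_neq0 // subrr mulr0 scale0r.
by rewrite (Ov_out lt') scaler0.
Qed.

Lemma u0 : u 0 = 1. Proof. exact: expr0. Qed.
Lemma dbl_pred m : m.+1.*2.-1 = m.*2.+1. Proof. by rewrite doubleS. Qed.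

Definition O_acts := (O0_even, O0_odd, O1_even, O1_odd, O2_even, O2_odd,
  O3_even, O3_odd, dbl_pred).
Definition O_lin := (mulmxDr, mulmxBr, mulmxN, =^~ scalemxAr).

Lemma double_ind (P : nat -> Prop) :
  P 0.*2 -> (forall m, P m.+1.*2) -> (forall m, P m.*2.+1) -> forall i, P i.
Proof.
move=> P0 Pe Po i; rewrite -[i]odd_double_half.
case: (odd i); first by rewrite add1n.
by case: (i./2).
Qed.

Lemma O_quad j i : O_mx j *m (O_mx j *m Ov i) =
  (O_par j + (O_par j)^-1) *: (O_mx j *m Ov i) - Ov i.
Proof.
have clr := (u0, subrr, mulr0, mul0r, scale0r, add0r, addr0).
case: j => [[|[|[|[|//]]]] lt4];
  [rewrite (_ : Ordinal lt4 = 0); last exact/val_inj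
  |rewrite (_ : Ordinal lt4 = 1); last exact/val_inj
  |rewrite (_ : Ordinal lt4 = 2); last exact/val_inj
  |rewrite (_ : Ordinal lt4 = 3); last exact/val_inj]; rewrite /O_par /=;
elim/double_ind: i => [|m|m];
do 4! rewrite ?(O_acts, O_lin, clr); rewrite ?uS; vec.
Qed.

Lemma O_mxK j : O_mx j *m O_mxV j = 1%:M.
Proof.
apply: mx_ext => i; rewrite /O_mxV mulmxBr mulmxBl mul_mx_scalar mul1mx.
by rewrite -mulmxA O_quad -scalemxAl opprB addrC subrK.
Qed.

Lemma O_mxVK j : O_mxV j *m O_mx j = 1%:M.
Proof. exact/mulmx1C/O_mxK. Qed.

Lemma O_prodv i : O_mx 0 *m (O_mx 1 *m Ov i) =
  q^-1 *: (O_mxV 3 *m (O_mxV 2 *m Ov i)).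
Proof.
have clr := (u0, subrr, mulr0, mul0r, scale0r, add0r, addr0).
have nzq1 : q * D * k0 * k1 * k2 != 0 by rewrite !mulf_neq0 //; nz.
have k3E : k3 = (q * D * k0 * k1 * k2)^-1.
  apply: (mulfI nzq1); rewrite divff //.
  have := O_kprod hO; rewrite -opprD -PoszD addn1 -exprnN exprS => kE.
  have -> : q * D * k0 * k1 * k2 * k3 = (q * D) * (k0 * k1 * k2 * k3) by ring.
  by rewrite kE divff // mulf_neq0 //; nz.
rewrite /O_mxV /O_par /= !(mulmxBl, mul_scalar_mx).
elim/double_ind: i => [|m|m];
do 4! rewrite ?(O_acts, O_lin, clr); rewrite ?uS ?u0 k3E; vec.
Qed.

Lemma O_family : DAHA_family q O_mx O_mxV.
Proof.
split=> [j|j|i j|]; [exact: O_mxK|exact: O_mxVK| |].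
  rewrite /O_mxV addrC subrK; exact/esym/scalar_mxC.
have H : O_mx 0 *m O_mx 1 = q^-1 *: (O_mxV 3 *m O_mxV 2).
  by apply: mx_ext => i; rewrite -scalemxAl -!mulmxA O_prodv.
rewrite [O_mx 0 * O_mx 1]H -mulrA [LHS]/GRing.mul /= -scalemxAl -mulmxA.
by rewrite [O_mxV 2 *m _]mulmxA O_mxVK mul1mx O_mxVK.
Qed.

End OAction.

Definition O_module (F : fieldType) (q : F) (hq : q != 0) (d : nat) (k0 k1 k2 k3 : F)
  (hO : O_params q d k0 k1 k2 k3) : Type := 'cV[F]_d.+1.

Arguments O_module {F q} hq d k0 k1 k2 k3 hO.

Section OModule.
Variables (F : fieldType) (q : F) (hq : q != 0) (d : nat) (k0 k1 k2 k3 : F).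
Local Notation H := (DAHA hq).

Variable hO : O_params q d k0 k1 k2 k3.
Local Notation V := (O_module hq d k0 k1 k2 k3 hO).
HB.instance Definition _ := GRing.Zmodule.copy V 'cV[F]_d.+1.

Definition O_rep : H -> 'M[F]_d.+1 := DAHA_lift (O_family hq hO).
HB.instance Definition _ := GRing.LRMorphism.on O_rep.

Definition O_scale (x : H) (v : V) : V := O_rep x *m (v : 'cV[F]_d.+1).

Lemma O_scaleA x y v : O_scale x (O_scale y v) = O_scale (x * y) v.
Proof. by rewrite /O_scale mulmxA rmorphM. Qed.

Lemma O_scale1 : left_id 1 O_scale.
Proof. by move=> v; rewrite /O_scale rmorph1 mul1mx. Qed.

Lemma O_scaleDr : right_distributive O_scale +%R.
Proof. by move=> x u v; apply: mulmxDr. Qed.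

Lemma O_scaleDl v : {morph O_scale^~ v : x y / x + y}.
Proof. by move=> x y; rewrite /O_scale rmorphD; apply: mulmxDl. Qed.

HB.instance Definition _ := GRing.Zmodule_isLmodule.Build H V
  O_scaleA O_scale1 O_scaleDr O_scaleDl.

Lemma O_tgen j i : (i <= d)%N ->
  tgen hq j *: (Ov F d i : V) = O_t q d k0 k1 k2 k3 j i :> 'cV[F]_d.+1.
Proof.
move=> le_id; transitivity (O_mx q d k0 k1 k2 k3 j *m Ov F d i).
  by congr (_ *m _); apply: lift_tgen.
by rewrite O_mxE le_id.
Qed.

Lemma O_const a (v : V) : a%:A *: v = a *: (v : 'cV[F]_d.+1) :> 'cV[F]_d.+1.
Proof.
transitivity (O_rep a%:A *m (v : 'cV[F]_d.+1)) => //.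
by rewrite linearZ rmorph1 -scalemxAl mul1mx.
Qed.

End OModule.

Lemma O_params_rot (F : fieldType) (q : F) d k0 k1 k2 k3 :
  O_params q d k0 k1 k2 k3 -> O_params q d k1 k2 k3 k0.
Proof.
case=> hd h0 h1 h2 h3 hk; split=> //; rewrite -hk; ring.
Qed.

(* Main.v *)
Require Import Defs.
From mathcomp Require Import all_boot all_order all_algebra.
From mathcomp Require Import ring.
From HB Require Import structures.
Import GRing.Theory.
Local Open Scope ring_scope.
Set Implicit Arguments.
Unset Strict Implicit.
Unset Printing Implicit Defensive.

(** Everything follows from a nonzero homomorphism from O(k0,k1,k2,k3) to the
twist W of O(k1,k2,k3,k0) by 3.  Rotating the parameters gives two more such
homomorphisms, and composing them reaches the twists by 3 + 3 = 2 and
3 + 3 + 3 = 1.  All modules have dimension d+1, so a nonzero homomorphism out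
of an irreducible O(k0,k1,k2,k3) is injective, hence bijective ([schur]).  In
particular the first map is invertible, so its composite with the second is
still nonzero, hence invertible in its turn, and so on.

To build the homomorphism, observe that the last basis vector w of
O(k1,k2,k3,k0) is, in W, an eigenvector of t_0 with value k0 and of t_3 with
value k3.  In any module on which t_j + t_j^-1 acts as k_j + k_j^-1, such a w
generates a sequence w_0 = w, w_1, w_2, ... on which the t_j act by the
formulas that define O(k0,k1,k2,k3), but without the truncation at i = d: this
is an infinite-dimensional Verma-type module.  Indeed the formulas for t_1 on
even vectors and for t_3 on odd ones define the sequence, and the remaining
ones follow by induction from the relations.  What is left is w_{d+1} = 0
([universal_intertwiner]).

For this, consider the Casimir element C = t_0 t_1 + (t_0 t_1)^-1, which
commutes with t_1, and put a_m = k0 k1 q^{2m} + (k0 k1 q^{2m})^-1.  In the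
sequence, (C - a_m) w_{2m-1} is a multiple of w_{2m+1} with nonzero factor, so
w_{d+1} is proportional to prod_{m=1}^{d/2} (C - a_m) applied to (t_1 - k1) w,
that is, to (t_1 - k1) applied to z = prod_m (C - a_m) w ([verma_casimir],
[verma_vanish]).  On the other side, in the basis v_i of O(k1,k2,k3,k0), the
operator C - a_m sends v_{2m} to a multiple of v_{2m-2} ([casimir_lower]), so
z is a multiple of v_0, which is an eigenvector of t_1 for the value k1. *)

(** * The universal property of O(k0,k1,k2,k3) *)

Definition act_lin := (mulmxDr, mulmxBr, mulmxN, =^~ scalemxAr).

Section Universal.
Variables (F : fieldType) (q : F) (d : nat) (k0 k1 k2 k3 : F).
Hypotheses (hq : q != 0) (hO : O_params q d k0 k1 k2 k3).
Variables (n : nat) (T S : 'Z_4 -> 'M[F]_n.+1).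
Hypothesis famT : DAHA_family q T S.
Local Notation par := (O_par k0 k1 k2 k3).
Hypothesis traceT : forall j, T j + S j = (par j + (par j)^-1)%:M.

Lemma act_inv j (x : 'cV_n.+1) :
  S j *m x = (par j + (par j)^-1) *: x - T j *m x.
Proof. by rewrite -mul_scalar_mx -traceT mulmxDl addrAC subrr add0r. Qed.

Lemma act_quad j (x : 'cV_n.+1) :
  T j *m (T j *m x) = (par j + (par j)^-1) *: (T j *m x) - x.
Proof.
have := act_inv j (T j *m x).
rewrite mulmxA [S j *m _](fam_mulVl famT) mul1mx => e.
by rewrite [X in _ = _ - X]e subKr.
Qed.

Lemma act01 (x : 'cV_n.+1) : T 0 *m (T 1 *m x) = q^-1 *: (S 3 *m (S 2 *m x)).
Proof.
have e2 : T 2 * (T 3 * (S 3 * S 2)) = 1.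
  by rewrite [T 3 * _]mulrA (fam_mulV famT) mul1r (fam_mulV famT).
have : T 0 * T 1 = q^-1 *: (S 3 * S 2).
  rewrite -[LHS]mulr1 -e2 !mulrA (fam_prod famT) -!mulrA.
  by rewrite -scalerAl mul1r.
by move=> e; rewrite mulmxA [T 0 *m _]e -scalemxAl mulmxA.
Qed.

Lemma act12 (x : 'cV_n.+1) : T 1 *m (T 2 *m x) = q^-1 *: (S 0 *m (S 3 *m x)).
Proof.
have : T 1 * T 2 = q^-1 *: (S 0 * S 3).
  have := fam_prod famT => /(congr1 (fun M => S 0 * M * S 3)).
  rewrite !mulrA (fam_mulVl famT) mul1r -!mulrA (fam_mulV famT) mulr1 => ->.
  by rewrite -scalerAl mul1r -scalerAr.
by move=> e; rewrite mulmxA [T 1 *m _]e -scalemxAl mulmxA.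
Qed.

Lemma act2 (x : 'cV_n.+1) : T 2 *m x = q^-1 *: (S 1 *m (S 0 *m (S 3 *m x))).
Proof.
by rewrite scalemxAr -act12 (mulmxA (S 1)) [S 1 *m _](fam_mulVl famT) mul1mx.
Qed.

(** The factors that t_0 and t_1 share on even basis vectors, and t_3 has on odd
ones, as functions of u = q^{2m}. *)
Definition even_coef (u : F) := (1 - u) * (1 - k0 ^+ 2 * u).
Definition odd_coef (u : F) :=
  (1 - k2 ^- 2 * (u / q ^+ d)) * (1 - u / q ^+ d).

Let par0 : par 0 = k0 := erefl.
Let par1 : par 1 = k1 := erefl.
Let par2 : par 2 = k2 := erefl.
Let par3 : par 3 = k3 := erefl.
Definition parE := (par0, par1, par2, par3).

Lemma O_k3E : k3 = (q * q ^+ d * k0 * k1 * k2)^-1.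
Proof.
have nz : q * q ^+ d * k0 * k1 * k2 != 0.
  by rewrite !mulf_neq0 ?expf_neq0 ?(O_k0 hO) ?(O_k1 hO) ?(O_k2 hO).
apply: (mulfI nz); rewrite divff //.
have := O_kprod hO; rewrite -opprD -PoszD addn1 -exprnN exprS => kE.
have -> : q * q ^+ d * k0 * k1 * k2 * k3
  = (q * q ^+ d) * (k0 * k1 * k2 * k3) by ring.
by rewrite kE divff // mulf_neq0 ?expf_neq0.
Qed.

Ltac nz := rewrite ?oner_eq0 ?(O_k0 hO) ?(O_k1 hO) ?(O_k2 hO)
  ?hq ?expf_neq0 //.

(** One step of the recursion: p, e, o, e' stand for the consecutive vectors
w_{2m-1}, w_{2m}, w_{2m+1}, w_{2m+2}, and u for q^{2m}.  The hypotheses [T1e]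
and [T3o] are the definitions of o and e'; the others are the induction
hypothesis.  Two mechanisms alternate below.  The product relation writes t_2 e
and t_0 t_1 o in terms of known inverse actions.  The quadratic relation of t_j
gives t_j y for any y that combines t_j x with vectors whose image under t_j is
known. *)
Section Step.
Variables (u : F) (hu : u != 0) (p e o e' : 'cV[F]_n.+1).
Hypotheses (T1p : T 1 *m p = k1^-1 *: p)
  (T0e : T 0 *m e = (k0^-1 / u * even_coef u) *: p
                    + (k0 + k0^-1 - k0^-1 / u) *: e)
  (T3e : T 3 *m e = k3 *: e)
  (T1e : T 1 *m e = - (k1 * even_coef u) *: p + k1 *: e + k1^-1 *: o)
  (T3o : T 3 *m o = - (k3^-1 * odd_coef u) *: e + k3^-1 *: o + k3 *: e').

Ltac vec := apply/colP => a; rewrite !mxE ?O_k3E /even_coef /odd_coef; field;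
  rewrite ?hu; nz.

Lemma step_T1 : T 1 *m o = k1^-1 *: o.
Proof.
have -> : o = k1 *: (T 1 *m e - k1 *: e + (k1 * even_coef u) *: p).
  by rewrite T1e; vec.
by rewrite ?(act_lin, act_quad, parE) T1e T1p; vec.
Qed.

Lemma step_T2e : T 2 *m e = (k2 * (q ^+ d / u)) *: (e - o).
Proof.
by rewrite act2; do 4! rewrite ?(act_inv, act_lin, T3e, T0e, T1e, T1p, parE); vec.
Qed.

Lemma step_T2o : T 2 *m o =
  (- k2 * (1 - k2 ^- 2 * (u / q ^+ d)) * (1 - q ^+ d / u)) *: e
  + (k2 + k2^-1 - k2 * (q ^+ d / u)) *: o.
Proof.
have {1}-> : o = e - (k2 * (q ^+ d / u))^-1 *: (T 2 *m e).
  by rewrite step_T2e; vec.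
by rewrite ?(act_lin, act_quad, parE) step_T2e; vec.
Qed.

Lemma step_T0o : T 0 *m o = (k0^-1 / (u * q * q)) *: (o - e').
Proof.
have -> : T 0 *m o = k1 *: (T 0 *m (T 1 *m o)).
  by rewrite step_T1 act_lin; vec.
rewrite act01.
by do 4! rewrite ?(act_inv, act_lin, T3e, T3o, step_T2o, parE); vec.
Qed.

Lemma step_T3e' : T 3 *m e' = k3 *: e'.
Proof.
have -> : e' = k3^-1 *: (T 3 *m o + (k3^-1 * odd_coef u) *: e - k3^-1 *: o).
  by rewrite T3o; vec.
by rewrite ?(act_lin, act_quad, parE) T3o T3e; vec.
Qed.

Lemma step_T0e' : T 0 *m e' =
  (k0^-1 / (u * q * q) * even_coef (u * q * q)) *: o
   + (k0 + k0^-1 - k0^-1 / (u * q * q)) *: e'.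
Proof.
have {1}-> : e' = o - (k0 * (u * q * q)) *: (T 0 *m o).
  by rewrite step_T0o; vec.
by rewrite ?(act_lin, act_quad, parE) step_T0o; vec.
Qed.

(** The terms in e cancel, which makes C - a_m a shift on odd vectors. *)
Lemma step_casimir :
  T 0 *m p = (k0^-1 / u) *: (p - e) ->
  T 0 *m (T 1 *m p) + S 1 *m (S 0 *m p) =
  (k0 * k1 * u + (k0 * k1 * u)^-1) *: p - (k0 * k1 * u)^-1 *: o.
Proof.
move=> T0p.
by do 4! rewrite ?(act_inv, act_lin, T0p, T0e, T1e, T1p, parE); vec.
Qed.
End Step.

(** [verma w m] is the pair (w_{2m-1}, w_{2m}), with w_{-1} = 0.  The two entries
are solved from the formulas of O(k0,k1,k2,k3) for t_1 w_{2m-2} and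
t_3 w_{2m-1}. *)
Fixpoint verma (w : 'cV[F]_n.+1) (m : nat) : 'cV[F]_n.+1 * 'cV[F]_n.+1 :=
  if m is m'.+1 then
    let: (p, e) := verma w m' in
    let o := k1 *: (T 1 *m e - k1 *: e + (k1 * even_coef (q ^+ m'.*2)) *: p) in
    (o, k3^-1 *: (T 3 *m o + (k3^-1 * odd_coef (q ^+ m'.*2)) *: e - k3^-1 *: o))
  else (0, w).

Variable w : 'cV[F]_n.+1.
Hypotheses (T0w : T 0 *m w = k0 *: w) (T3w : T 3 *m w = k3 *: w).
Local Notation vo m := (verma w m).1.
Local Notation ve m := (verma w m).2.
Local Notation u m := (q ^+ m.*2).

Let u_nz m : u m != 0. Proof. exact: expf_neq0. Qed.

Let uS m : u m.+1 = u m * q * q.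
Proof. by rewrite doubleS !exprSr. Qed.

Lemma verma_T1e m : T 1 *m ve m =
  - (k1 * even_coef (u m)) *: vo m + k1 *: ve m + k1^-1 *: vo m.+1.
Proof.
rewrite /=; case: (verma w m) => p e /=.
by apply/colP=> a; rewrite !mxE; move: (\sum__ _) => ?; field; nz.
Qed.

Lemma verma_T3o m : T 3 *m vo m.+1 =
  - (k3^-1 * odd_coef (u m)) *: ve m + k3^-1 *: vo m.+1 + k3 *: ve m.+1.
Proof.
rewrite /=; case: (verma w m) => p e /=.
move: (k1 *: _) => o; move: (T 3 *m o) => y.
by apply/colP=> a; rewrite !mxE; field; apply: (O_k3 hO).
Qed.

(** The part of the action that the recursion step needs from the previous
one. *)
Lemma verma_lower m : [/\ T 1 *m vo m = k1^-1 *: vo m,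
  T 0 *m ve m = (k0^-1 / u m * even_coef (u m)) *: vo m
                + (k0 + k0^-1 - k0^-1 / u m) *: ve m
  & T 3 *m ve m = k3 *: ve m].
Proof.
elim: m => [|m [T1p T0e T3e]].
  split=> //; first by rewrite /= mulmx0 scaler0.
  by rewrite /= scaler0 add0r expr0 divr1 addrK.
split; first exact: step_T1 T1p (verma_T1e m).
  rewrite uS; exact: step_T0e' T1p T0e T3e (verma_T1e m) (verma_T3o m).
exact: step_T3e' T3e (verma_T3o m).
Qed.

(** The formulas on w_0, ..., w_d involve no vector beyond w_{d+1}; when that one
vanishes (it is the odd entry of index d/2 + 1), they are those of
O(k0,k1,k2,k3), and v_i |-> w_i is a homomorphism. *)
Lemma universal_intertwiner : vo (d./2).+1 = 0 ->
  exists P : 'M[F]_(n.+1, d.+1), P *m Ov F d 0 = w /\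
    forall j, T j *m P = P *m O_mx q d k0 k1 k2 k3 j.
Proof.
move=> vo0.
pose v i := if odd i then vo (i./2).+1 else ve i./2.
pose P : 'M[F]_(n.+1, d.+1) := \matrix_(a, i) v i a 0.
have Pv i : (i <= d.+1)%N -> P *m Ov F d i = v i.
  rewrite leq_eqVlt ltnS => /orP[/eqP->|le].
    rewrite Ov_out // mulmx0 /v /= (O_even hO) /=.
    by rewrite uphalf_half (negbTE (O_even hO)) vo0.
  rewrite (OvE _ (Ordinal (le : (i < d.+1)%N))) -colE.
  by apply/colP => a; rewrite !mxE.
have Pe m : (m.*2 <= d.+1)%N -> P *m Ov F d m.*2 = ve m.
  by move=> /Pv->; rewrite /v odd_double doubleK.
have Po m : (m.*2.+1 <= d.+1)%N -> P *m Ov F d m.*2.+1 = vo m.+1.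
  by move=> /Pv->; rewrite /v /= odd_double /= uphalf_double.
exists P; split=> [|j]; first exact: Pv.
suff H i : (i <= d)%N -> T j *m (P *m Ov F d i)
    = P *m (O_mx q d k0 k1 k2 k3 j *m Ov F d i).
  apply/matrixP=> a b; have /colP/(_ a) := H b (ltn_ord b).
  by rewrite !mulmxA !OvE -!colE !mxE.
have acts := @O_acts F q d k0 k1 k2 k3 hq hO.
(* At m = 0 the index m.*2.-1 is 0 instead of -1, but the coefficient is 0. *)
have lower c m : (m.*2 <= d.+1)%N ->
    (c * even_coef (u m)) *: (P *m Ov F d m.*2.-1)
    = (c * even_coef (u m)) *: vo m.
  case: m => [|m] le; first by rewrite /even_coef expr0 subrr mul0r mulr0 !scale0r.
  by rewrite doubleS /= Po // ltnW // -doubleS.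
rewrite -[i]odd_double_half.
move: i./2 => m; have [T1p T0e T3e] := verma_lower m.
have hu := u_nz m.
case: j => [[|[|[|[|//]]]] lt4];
  [rewrite (_ : Ordinal lt4 = 0); last exact/val_inj
  |rewrite (_ : Ordinal lt4 = 1); last exact/val_inj
  |rewrite (_ : Ordinal lt4 = 2); last exact/val_inj
  |rewrite (_ : Ordinal lt4 = 3); last exact/val_inj];
(case: (odd i); rewrite ?add1n ?add0n => le;
  [have le' : (m.+1.*2 <= d.+1)%N by rewrite doubleS ltnS
  |have le' : (m.*2.+1 <= d.+1)%N by []]).
all: have le2 : (m.*2.+1 <= d.+1)%N by first [exact: leqW | exact: le'].
all: have le1 := ltnW le2.
all: rewrite acts ?act_lin ?Pe ?Po //.
- by rewrite uS; apply: step_T0o T1p T0e T3e (verma_T1e m) (verma_T3o m).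
- by rewrite -mulrA lower // T0e.
- exact: step_T1 T1p (verma_T1e m).
- by rewrite -mulrA lower // mulNr verma_T1e.
- exact: step_T2o T1p T0e T3e (verma_T1e m).
- exact: step_T2e T1p T0e T3e (verma_T1e m).
- by rewrite verma_T3o -mulrA mulNr.
Qed.

Definition casimir : 'M[F]_n.+1 := T 0 * T 1 + S 1 * S 0.
Definition casimir_val m := k0 * k1 * u m + (k0 * k1 * u m)^-1.

(** By the quadratic relations, t_1 C and C t_1 both equal
t_1 t_0 t_1 + t_0^-1. *)
Lemma casimir_comm1 : comm_mx (T 1) casimir.
Proof.
pose c j := par j + (par j)^-1.
have SE j (M : 'M_n.+1) : S j * M = c j *: M - T j * M.
  by rewrite -[c j *: M]mul_scalar_mx -traceT mulmxDl addrAC subrr add0r.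
have xyy : T 0 * T 1 * T 1 = c 1 *: (T 0 * T 1) - T 0.
  have := congr1 ( *%R (T 0)) (SE 1 (T 1)).
  rewrite (fam_mulVl famT) mulr1 mulrBr -scalerAr mulrA => e.
  by rewrite [X in _ = _ - X]e subKr.
rewrite /comm_mx /casimir -!/(_ * _) mulrDr mulrDl xyy.
rewrite [T 1 * (S 1 * _)]mulrA (fam_mulV famT) mul1r.
rewrite -[S 1 * S 0 * _]mulrA (SE 0) mulrBr -scalerAr (fam_mulVl famT) SE.
have -> : S 0 = (c 0)%:A - T 0 by rewrite -[S 0]mulr1 SE mulr1.
by rewrite [RHS]addrC opprB !addrA subrK [(c 0)%:A + _]addrC.
Qed.

(** Kept as a polynomial in C, so that its factors can be taken in any order and
it commutes with whatever C commutes with. *)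
Definition casimir_poly m : {poly F} :=
  \prod_(i < m) ('X - (casimir_val i.+1)%:P).

(** Iterates the shift [step_casimir], starting from w_1 = k1 (t_1 - k1) w. *)
Lemma verma_casimir m : exists c,
  vo m.+1 = c *: (horner_mx casimir (casimir_poly m) *m (T 1 *m w - k1 *: w)).
Proof.
elim: m => [|m [c IH]].
  exists k1; rewrite /casimir_poly big_ord0 rmorph1 mul1mx /=.
  by rewrite scaler0 addr0.
have [T1p T0e T3e] := verma_lower m.
have [T1p' _ _] := verma_lower m.+1.
have T0p : T 0 *m vo m.+1 = (k0^-1 / (u m * q * q)) *: (vo m.+1 - ve m.+1).
  exact: step_T0o T1p T0e T3e (verma_T1e m) (verma_T3o m).
rewrite -uS in T0p.
have := step_casimir (u_nz m.+1) T1p' (verma_T1e _) T0p.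
have nz : k0 * k1 * u m.+1 != 0.
  exact: (mulf_neq0 (mulf_neq0 (O_k0 hO) (O_k1 hO)) (u_nz _)).
rewrite !mulmxA -mulmxDl => cas.
have {cas} : vo m.+2 = - (k0 * k1 * u m.+1) *:
    ((casimir - (casimir_val m.+1)%:M) *m vo m.+1).
  rewrite mulmxBl mul_scalar_mx [casimir *m _]cas /casimir_val addrAC subrr add0r.
  by rewrite scalerN scaleNr opprK scalerA mulfV // scale1r.
rewrite IH => ->; exists (- (k0 * k1 * u m.+1) * c).
rewrite [casimir_poly m.+1]big_ord_recr /= [_ * ('X - _)]mulrC.
rewrite rmorphM rmorphB /=.
by rewrite horner_mx_X horner_mx_C -scalemxAr scalerA [in LHS]mulmxA.
Qed.

(** At m = d/2 this provides the vanishing that [universal_intertwiner] asks for: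
C commutes with t_1, so t_1 - k1 can be applied last. *)
Lemma verma_vanish m :
  T 1 *m (horner_mx casimir (casimir_poly m) *m w) =
    k1 *: (horner_mx casimir (casimir_poly m) *m w) ->
  vo m.+1 = 0.
Proof.
move=> E; have [c ->] := verma_casimir m.
rewrite mulmxBr mulmxA -(comm_mx_horner _ casimir_comm1) -mulmxA E.
by rewrite -scalemxAr subrr scaler0.
Qed.
End Universal.

(** * The homomorphism into the rotated module *)

Lemma DAHA_family_rot (F : fieldType) (q : F) (hq : q != 0) (A : algType F)
    (t s : 'Z_4 -> A) (e : 'Z_4) : DAHA_family q t s ->
  DAHA_family q (fun j => t (j + e)) (fun j => s (j + e)).
Proof.
move=> ts; split=> [i|i|i j|];
  [exact: fam_mulV ts _|exact: fam_mulVl ts _|exact: fam_central ts _ _|].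
have := congr1 (DAHA_lift ts) (tgen_rot hq e).
by rewrite -HconstE !rmorphM add0r /= !lift_tgen [DAHA_lift ts (Hconst _ _)]lift_cls.
Qed.

Section Rotate.
Variables (F : fieldType) (q : F) (d : nat) (k0 k1 k2 k3 : F).
Hypotheses (hq : q != 0) (hO : O_params q d k0 k1 k2 k3).
Let hO' := O_params_rot hO.
Local Notation T := (fun j : 'Z_4 => O_mx q d k1 k2 k3 k0 (j + 3)).
Local Notation S := (fun j : 'Z_4 => O_mxV q d k1 k2 k3 k0 (j + 3)).
Local Notation v := (Ov F d).
Local Notation u m := (q ^+ m.*2).

Lemma O_par_rot j : O_par k1 k2 k3 k0 (j + 3) = O_par k0 k1 k2 k3 j.
Proof. by case: j => [[|[|[|[|//]]]] lt4]. Qed.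

Lemma O_mx_trace j :
  T j + S j = (O_par k0 k1 k2 k3 j + (O_par k0 k1 k2 k3 j)^-1)%:M.
Proof. by rewrite /O_mxV O_par_rot addrC subrK. Qed.

(** The multiple of v_{2m+1} in C v_{2m+2} cancels between t_0 t_1 and its
inverse; this is why lowering by two goes with a single factor C - a_{m+1}. *)
Lemma casimir_lower m : exists c,
  (casimir T S - (casimir_val q k0 k1 m.+1)%:M) *m v m.+1.*2 = c *: v m.*2.
Proof.
exists (- (k1^-1 / u m.+1 * (1 - u m.+1) * (1 - k1 ^+ 2 * u m.+1)
   * (k0^-1 * odd_coef q d k3 (u m)))).
have e0 : (0 + 3 : 'Z_4) = 3 by exact/val_inj.
have e1 : (1 + 3 : 'Z_4) = 0 by exact/val_inj.
rewrite /casimir e0 e1 mulmxBl mulmxDl -!mulmxA mul_scalar_mx.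
rewrite /O_mxV /O_par /= !(mulmxBl, mul_scalar_mx).
do 4! rewrite ?(@O_acts F q d k1 k2 k3 k0 hq hO') ?act_lin.
apply/colP => a; rewrite !mxE /odd_coef /casimir_val doubleS !exprSr; field.
by rewrite !expf_neq0 ?hq ?(O_k0 hO) ?(O_k1 hO) ?(O_k3 hO) ?(O_k2 hO).
Qed.

Lemma casimir_poly_last m : exists c,
  horner_mx (casimir T S) (casimir_poly q k0 k1 m) *m v m.*2 = c *: v 0.
Proof.
elim: m => [|m [c IH]].
  by exists 1; rewrite /casimir_poly big_ord0 rmorph1 mul1mx scale1r.
have [b E] := casimir_lower m; exists (b * c).
rewrite [casimir_poly _ _ _ m.+1]big_ord_recr rmorphM /= rmorphB /=.
by rewrite horner_mx_X horner_mx_C -mulmxA E -scalemxAr IH scalerA.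
Qed.

(** P sends v_0 to the last basis vector of O(k1,k2,k3,k0), on which t_2 and t_3
of that module act by the scalars k3 and k0. *)
Lemma rotation_intertwiner : exists2 P : 'M[F]_d.+1, P != 0 &
  forall j, O_mx q d k1 k2 k3 k0 (j + 3) *m P
            = P *m O_mx q d k0 k1 k2 k3 j.
Proof.
have famT := DAHA_family_rot hq 3 (O_family hq hO').
have e0 : (0 + 3 : 'Z_4) = 3 by exact/val_inj.
have e1 : (1 + 3 : 'Z_4) = 0 by exact/val_inj.
have e3 : (3 + 3 : 'Z_4) = 2 by exact/val_inj.
have T0w : T 0 *m v d = k0 *: v d.
  by rewrite e0 [X in v X](O_even_d hO') O3_even -(O_even_d hO').
have T3w : T 3 *m v d = k3 *: v d.
  rewrite e3 [X in v X](O_even_d hO') (@O2_even F q d k1 k2 k3 k0 hq).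
  rewrite -(O_even_d hO') divff ?expf_neq0 // mulr1.
  by rewrite (Ov_out F (ltnSn d)) subr0.
have vanish := @verma_vanish F q d k0 k1 k2 k3 hq hO d _ _ famT O_mx_trace _
  T0w T3w d./2.
have [|P [Pw PT]] := universal_intertwiner hq hO famT O_mx_trace T0w T3w.
  apply: vanish; have [c] := casimir_poly_last d./2.
  rewrite -(O_even_d hO') => ->.
  rewrite -scalemxAr e1 -[0%N]/0.*2 (O0_even hO') /= expr0 subrr.
  rewrite mulr0 mul0r scale0r add0r invr1 mulr1 addrK !scalerA.
  by rewrite mulrC.
exists P => //; apply/eqP => P0; move: Pw; rewrite P0 mul0mx.
move=> /colP/(_ ord_max)/eqP.
by rewrite !mxE eqxx eq_sym oner_eq0.
Qed.
End Rotate.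

(** * From intertwining matrices to module isomorphisms *)

Lemma eval_twist (F : fieldType) (q : F) (hq : q != 0) (A : algType F)
    (t s : 'Z_4 -> A) (ts : DAHA_family q t s) (e : 'Z_4) x :
  DAHA_lift ts (DAHA_rot e (cls hq x)) =
  eval (fun j => t (j + e)) (fun j => s (j + e)) x.
Proof.
rewrite [DAHA_rot _ _]lift_cls.
elim: x => [a|j|j|x IHx y IHy|x IHx y IHy] /=.
- by rewrite -HconstE [LHS]lift_cls.
- exact: lift_tgen.
- exact: lift_tgenV.
- by rewrite rmorphD /= IHx IHy.
- by rewrite rmorphM /= IHx IHy.
Qed.

(** Intertwining the t_j forces intertwining their inverses. *)
Lemma eval_intertwine (F : fieldType) (q : F) (n m : nat) (t s : 'Z_4 -> 'M[F]_n.+1)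
    (t' s' : 'Z_4 -> 'M[F]_m.+1) (P : 'M[F]_(m.+1, n.+1)) :
  DAHA_family q t s -> DAHA_family q t' s' ->
  (forall j, t' j *m P = P *m t j) ->
  forall x, eval t' s' x *m P = P *m eval t s x.
Proof.
move=> ts ts' tP; elim=> [a|j|j|x IHx y IHy|x IHx y IHy] //=.
- by rewrite -scalemxAl -scalemxAr mul1mx mulmx1.
- rewrite -[LHS]mulmx1 -[1%:M](fam_mulV ts j) -!mulmxA (mulmxA P) -tP.
  by rewrite -mulmxA (mulmxA (s' j)) [s' j *m _](fam_mulVl ts') mul1mx.
- by rewrite mulmxDl mulmxDr IHx IHy.
- by rewrite -[_ * _ *m P]mulmxA IHy mulmxA IHx -mulmxA.
Qed.

Section Intertwiner.
Variables (F : fieldType) (q : F) (hq : q != 0) (d : nat).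
Variables (k0 k1 k2 k3 l0 l1 l2 l3 : F) (e : 'Z_4).
Variables (hk : O_params q d k0 k1 k2 k3) (hl : O_params q d l0 l1 l2 l3).
Variable P : 'M[F]_d.+1.
Local Notation V := (O_module hq d k0 k1 k2 k3 hk).
Local Notation W := (O_module hq d l0 l1 l2 l3 hl).

Definition intertwines :=
  forall j, O_mx q d l0 l1 l2 l3 (j + e) *m P = P *m O_mx q d k0 k1 k2 k3 j.

Definition intertwiner_map (_ : intertwines) (x : V) : twist e W :=
  P *m (x : 'cV[F]_d.+1).

Hypothesis hP : intertwines.

Lemma intertwiner_zmod : zmod_morphism (intertwiner_map hP).
Proof. by move=> x y; apply: mulmxBr. Qed.

Lemma intertwiner_scalable : scalable (intertwiner_map hP).
Proof.
move=> a x; rewrite -[a]rpK; move: (rp a) => {}a.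
transitivity (P *m (eval (O_mx q d k0 k1 k2 k3) (O_mxV q d k0 k1 k2 k3) a
                    *m (x : 'cV[F]_d.+1))).
  by congr (P *m (_ *m _)); apply: lift_cls.
transitivity (DAHA_lift (O_family hq hl) (DAHA_rot e (cls hq a))
              *m (P *m (x : 'cV[F]_d.+1))) => //.
have tw := DAHA_family_rot hq e (O_family hq hl).
by rewrite eval_twist !mulmxA (eval_intertwine (O_family hq hk) tw hP).
Qed.

HB.instance Definition _ :=
  GRing.isZmodMorphism.Build V (twist e W) (intertwiner_map hP) intertwiner_zmod.
HB.instance Definition _ :=
  GRing.isScalable.Build (DAHA hq) V (twist e W) *:%R (intertwiner_map hP)
    intertwiner_scalable.

(** The kernel is a proper submodule, hence zero, and an injective square matrix
is invertible.  Invertibility of P is part of the conclusion because it keeps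
composites with P nonzero. *)
Lemma schur : irreducible_module V -> P != 0 ->
  P \in unitmx /\ isomorphic_modules V (twist e W).
Proof.
move=> [_ simV] Pn0.
pose K : {pred V} := fun x => P *m (x : 'cV[F]_d.+1) == 0.
have subK : submod_closed K.
  split=> [|a x y]; first by apply/eqP; apply: mulmx0.
  move=> /eqP fx /eqP fy; apply/eqP.
  pose f : {linear V -> twist e W} := intertwiner_map hP.
  have {}fx : f x = 0 := fx; have {}fy : f y = 0 := fy.
  by change (f (a *: x + y) = 0); rewrite linearP fx fy scaler0 addr0.
have uP : P \in unitmx.
  rewrite -unitmx_tr -row_free_unit -kermx_eq0; apply/rowV0P => x.
  move=> /sub_kermxP/(congr1 trmx); rewrite trmx_mul trmxK trmx0 => Px.
  case: (simV K subK) => [K0|KT].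
    by apply: trmx_inj; rewrite trmx0; apply: (K0 x^T); apply/eqP.
  case/eqP: Pn0; apply: mx_ext => i; rewrite mul0mx.
  by apply/eqP; apply: (KT (Ov F d i)).
split=> //; exists (intertwiner_map hP : {linear V -> twist e W}).
exists (fun y => invmx P *m (y : 'cV[F]_d.+1)) => x.
  exact: mulKmx.
exact: mulKVmx.
Qed.

End Intertwiner.

(** * Rotating three times *)

Theorem theorem2p5 (F : fieldType) (q : F) (hq : q != 0) (d : nat)
    (k0 k1 k2 k3 : F)
    (hd : ~~ odd d)
    (hk0 : k0 != 0) (hk1 : k1 != 0) (hk2 : k2 != 0) (hk3 : k3 != 0)
    (hk : k0 * k1 * k2 * k3 = q ^ (- d%:Z - 1)) :
  let h0 := OParams hd hk0 hk1 hk2 hk3 hk in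
  let h1 := O_params_rot h0 in
  let h2 := O_params_rot h1 in
  let h3 := O_params_rot h2 in
  irreducible_module (O_module hq d k0 k1 k2 k3 h0) ->
  [/\ isomorphic_modules (O_module hq d k0 k1 k2 k3 h0)
        (twist (3 : 'Z_4) (O_module hq d k1 k2 k3 k0 h1)),
      isomorphic_modules (O_module hq d k0 k1 k2 k3 h0)
        (twist (2 : 'Z_4) (O_module hq d k2 k3 k0 k1 h2))
    & isomorphic_modules (O_module hq d k0 k1 k2 k3 h0)
        (twist (1 : 'Z_4) (O_module hq d k3 k0 k1 k2 h3))].
Proof.
move=> h0 h1 h2 h3 irr.
have [P P0 hP] := rotation_intertwiner hq h0.
have [Q Q0 hQ] := rotation_intertwiner hq h1.
have [R R0 hR] := rotation_intertwiner hq h2.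
have [uP iso1] := schur h1 hP irr P0.
have QP0 : Q *m P != 0.
  by apply: contra_neq Q0 => QP; rewrite -[Q](mulmxK uP) QP mul0mx.
have hQP : intertwines q k0 k1 k2 k3 k2 k3 k0 k1 2 (Q *m P).
  move=> j; have -> : j + 2 = j + 3 + 3.
    by rewrite -addrA; congr (j + _); exact/val_inj.
  by rewrite mulmxA hQ -mulmxA hP mulmxA.
have [uQP iso2] := schur h2 hQP irr QP0.
have RQP0 : R *m (Q *m P) != 0.
  by apply: contra_neq R0 => RQP; rewrite -[R](mulmxK uQP) RQP mul0mx.
have hRQP : intertwines q k0 k1 k2 k3 k3 k0 k1 k2 1 (R *m (Q *m P)).
  move=> j; have -> : j + 1 = j + 2 + 3.
    by rewrite -addrA; congr (j + _); exact/val_inj.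
  by rewrite mulmxA hR -mulmxA hQP mulmxA.
by have [_ iso3] := schur h3 hRQP irr RQP0.
Qed.
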